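(* Let $\mathcal{D}$ be a weighted oriented graph with vertex set $\{1,\ldots,n\}$ and underlying graph $G$, let $K$ be a field, $R=K[x_1,\ldots,x_n]$, and let $I(\mathcal{D})\subseteq R$ be the edge ideal of $\mathcal{D}$. Let $V^+(\mathcal{D})=\{v\in V(\mathcal{D})\mid \omega(v)\ge 2\}$. For any integer $t\geqslant 2$, the following conditions are equivalent: (1) $I(\mathcal{D})^t=I(\mathcal{D})^{(t)}$. (2) Every vertex in $V^{+}(\mathcal{D})$ is a sink, and $G$ contains no odd cycle of length $2s-1$ for any $2\leqslant s\leqslant t$.
   Context: An oriented graph $\mathcal{D}=(V(\mathcal{D}),E(\mathcal{D}))$ consists of a finite simple graph $G$ (its underlying graph) in which each edge is given exactly one orientation; $(u,v)\in E(\mathcal{D})$ denotes an edge directed from $u$ to $v$. A weighted oriented graph is an oriented graph together with a weight function $\omega\colon V(\mathcal{D})\to\mathbb{Z}_{>0}$. A sink is a vertex with only incoming edges; a source is a vertex with only outgoing edges. It is always assumed that $\omega(v)=1$ whenever $v$ is a source (this does not affect the edge ideal). With $V(\mathcal{D})=\{1,\ldots,n\}$ and $R=K[x_1,\ldots,x_n]$, $K$ a field, the edge ideal is $I(\mathcal{D})=(x_ix_j^{\omega(j)}\mid (i,j)\in E(\mathcal{D}))$. For an ideal $I\subseteq R$ and $t\ge 1$, the $t$-th symbolic power is $I^{(t)}=\bigcap_{p\in \mathrm{Min}(I)} (I^tR_p\cap R)$, where $\mathrm{Min}(I)$ is the set of minimal primes of $I$. ''Contains a cycle'' means contains it as a (not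 necessarily induced) subgraph. *)

(* Defs.v *)
From mathcomp Require Import all_boot all_order all_algebra.
From mathcomp Require Import classical_sets.
From mathcomp Require Import mpoly.

Set Implicit Arguments.
Unset Strict Implicit.
Unset Printing Implicit Defensive.

Import GRing.Theory.
Local Open Scope classical_set_scope.
Local Open Scope ring_scope.

Section OrientedGraphs.
Variables (n : nat) (edge : rel 'I_n).

(* A vertex without any edge is both a source and a sink. *)
Definition source_vertex (v : 'I_n) := [forall u, ~~ edge u v].
Definition sink_vertex (v : 'I_n) := [forall u, ~~ edge v u].

Definition underlying : rel 'I_n := [rel u v | edge u v || edge v u].

End OrientedGraphs.

(* The vertices 1, ..., n are indexed by 0, ..., n - 1; [edge D u v] is the
   edge directed from u to v. *)
Record wograph (n : nat) := WOGraph {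
  edge : rel 'I_n;
  weight : 'I_n -> nat;
  edge_irr : irreflexive edge;
  edge_asym : forall u v, edge u v -> ~~ edge v u;
  weight_gt0 : forall v, (0 < weight v)%N;
  weight_source : forall v, source_vertex edge v -> weight v = 1%N
}.

(* The vertices of the cycle are pairwise distinct; 2 < k rules out the closed
   walks x, y, x, which [ucycle] accepts as cycles of length 2. *)
Definition contains_cycle (T : finType) (adj : rel T) (k : nat) : Prop :=
  exists c : seq T, [/\ (2 < k)%N, size c = k & ucycle adj c].

Definition underlying_graph n (D : wograph n) : rel 'I_n := underlying (edge D).

Definition Vplus n (D : wograph n) : set 'I_n := [set v | (1 < weight D v)%N].

Definition is_sink n (D : wograph n) (v : 'I_n) : bool :=
  sink_vertex (edge D) v.

Section Ideals.
Variable R : comNzRingType.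
Implicit Types S A I J p : set R.

(* I is an ideal of the subring S of R. *)
Definition ideal_of S I : Prop :=
  [/\ I `<=` S,
      I 0,
      (forall x y, I x -> I y -> I (x + y)) &
      (forall a x, S a -> I x -> I (a * x))].

Definition ideal_gen S A : set R := smallest (ideal_of S) A.

Definition ideal_mul I J : set R :=
  ideal_gen setT [set x * y | x in I & y in J].

Definition ideal_pow I (t : nat) : set R := iter t (ideal_mul I) setT.

Definition prime_ideal p : Prop :=
  [/\ ideal_of setT p, ~ p 1 & forall x y, p (x * y) -> p x \/ p y].

Definition minimal_primes I : set (set R) :=
  [set p | [/\ prime_ideal p, I `<=` p &
    forall q, prime_ideal q -> I `<=` q -> q `<=` p -> q = p]].

End Ideals.

Section SymbolicPowers.
Variable R : idomainType.
Implicit Types (p I J : set R).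

(* R_p, as a subring of the fraction field of the domain R. *)
Definition localization p : set {fraction R} :=
  [set tofrac a / tofrac s | a in setT & s in ~` p].

(* J R_p, the extension of J to R_p. *)
Definition local_ext p J : set {fraction R} :=
  ideal_gen (localization p) [set tofrac f | f in J].

Definition symbolic_pow I (t : nat) : set R :=
  \bigcap_(p in minimal_primes I)
    [set f | local_ext p (ideal_pow I t) (tofrac f)].

End SymbolicPowers.

Definition edge_ideal (K : fieldType) n (D : wograph n) : set {mpoly K[n]} :=
  ideal_gen setT
    [set f | exists i j, edge D i j /\ f = 'X_i * 'X_j ^+ weight D j].

Arguments edge_ideal K {n} D.

(* Main.v *)
Require Import Defs.
From mathcomp Require Import all_boot all_order all_algebra.
From mathcomp Require Import boolp classical_sets.
From mathcomp Require Import mpoly.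
From mathcomp Require Import zify.

(** Everything reduces to monomials.  A polynomial lies in I^t exactly when each
    of its monomials is divisible by a product of t generators
    ([edge_ideal_powE]).  The minimal primes of I are generated by the variables
    of the minimal vertex covers C of G ([minimal_primesE]), and f lies in I^(t)
    exactly when, for each monomial m of f and each such C, some multiple of m
    by variables outside C is divisible by a product of t generators
    ([edge_ideal_symbolicE]); this rests on [var_saturation], the fact that
    elements outside a prime generated by variables can be cancelled modulo a
    monomial ideal that only sees these variables.  Both conditions of the
    theorem thus become statements about exponents.

    Suppose that vertices of weight at least 2 are sinks.  Every generator is then
    a product x_i^w(i) x_j^w(j) over an edge ij, so only k(v) = floor(m_v / w(v))
    matters: m is in I^t iff there are t edges, with repetition, covering each v
    at most k(v) times, and m in I^(t) forces every vertex cover to have k-weight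
    at least t.  Without short odd cycles the second condition implies the first
    ([edges_within_cover]): an odd cycle inside the support of k has length at
    least 2t + 1 and already contains t disjoint edges; if there is none, the
    support is bipartite and the weighted Koenig theorem
    ([bipartite_duality]) applies.

    Conversely, each violation yields a monomial of I^(t) outside I^t.
    If a -> b -> c with w(b) >= 2, take
    x_a x_b^w(b) x_c^w(c) (x_b x_c^w(c))^(t-2): a linear functional
    that is at least N on all generators is smaller than t N on it
    ([path_monomial_not_in]).  Otherwise the heavy vertices are
    sinks, and for an odd cycle of length 2s - 1 with s <= t one takes the product
    of the x_v^w(v) over the cycle times the (t - s)-th power of a generator:
    a cover meets the cycle in at least s vertices, but the total degree, counted
    in units of w(v), is 2t - 1 < 2t ([cycle_monomial_not_in]). *)

Set Implicit Arguments.
Unset Strict Implicit.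
Unset Printing Implicit Defensive.

(** * Multisets of edges and weighted vertex covers *)

Section Matchings.
Variable T : finType.
Implicit Types (e : rel T) (A C : {set T}) (k : T -> nat) (s : seq (T * T)).

Definition vertex_cover e C :=
  [forall x, forall y, e x y ==> (x \in C) || (y \in C)].

Lemma vertex_coverP e C :
  reflect (forall x y, e x y -> (x \in C) || (y \in C)) (vertex_cover e C).
Proof.
apply: (iffP forallP) => [h x y exy|h x].
  by have /forallP/(_ y)/implyP/(_ exy) := h x.
by apply/forallP => y; apply/implyP/h.
Qed.

Definition edge_deg s (v : T) := \sum_(p <- s) ((p.1 == v) + (p.2 == v)).

Lemma edge_deg_cons p s v :
  edge_deg (p :: s) v = (p.1 == v) + (p.2 == v) + edge_deg s v.
Proof. by rewrite /edge_deg big_cons. Qed.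

(** Weighted matchings: an integral feasible solution, of total value t, of the
    packing of edges under the vertex capacities k. *)
Definition edges_within e k t :=
  exists s, [/\ size s = t, all (fun p => e p.1 p.2) s
              & forall v, edge_deg s v <= k v].

Lemma sum_pred1 (P : pred T) a : \sum_(x | P x) (a == x) = P a.
Proof.
rewrite big_mkcond (bigD1 a) //= eqxx big1 ?addn0; first by case: (P a).
by move=> i ia; rewrite eq_sym (negbTE ia); case: ifP.
Qed.

Lemma sum_edge_deg (P : pred T) s :
  \sum_(v | P v) edge_deg s v = \sum_(p <- s) (P p.1 + P p.2).
Proof.
rewrite /edge_deg exchange_big /=; apply: eq_bigr => p _.
by rewrite big_split /= !sum_pred1.
Qed.

Lemma cover_edge_deg e C s :
  vertex_cover e C -> all (fun p => e p.1 p.2) s ->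
  size s <= \sum_(v in C) edge_deg s v.
Proof.
move=> /vertex_coverP cov; rewrite sum_edge_deg.
elim: s => [|p s IH] //= /andP[ep /IH]; rewrite big_cons.
by have /orP[] := cov _ _ ep => ->; lia.
Qed.

(** Two covers of a bipartite graph can be crossed: one takes the intersection
    on the side A and the union on the other, the other one does the opposite.
    The total weight is unchanged, so when both covers are of the least possible
    weight, so are the crossed ones. *)
Lemma tight_pair_cover e A k t C D :
  (forall x y, e x y -> (x \in A) != (y \in A)) ->
  (forall B, vertex_cover e B -> t <= \sum_(x in B) k x) ->
  vertex_cover e C -> vertex_cover e D ->
  \sum_(x in C) k x <= t -> \sum_(x in D) k x <= t ->
  let J := [set x | if x \in A then (x \in C) && (x \in D)
                    else (x \in C) || (x \in D)] in
  vertex_cover e J /\ \sum_(x in J) k x <= t.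
Proof.
move=> bip tmin /vertex_coverP covC /vertex_coverP covD kC kD J.
(* the opposite crossing; its weight is at least t, which bounds that of J *)
pose M := [set x | if x \in A then (x \in C) || (x \in D)
                   else (x \in C) && (x \in D)].
have covJ : vertex_cover e J.
  apply/vertex_coverP => x y exy; have := bip _ _ exy.
  have := covC _ _ exy; have := covD _ _ exy; rewrite !inE.
  by do 6![case: (_ \in _)].
have covM : vertex_cover e M.
  apply/vertex_coverP => x y exy; have := bip _ _ exy.
  have := covC _ _ exy; have := covD _ _ exy; rewrite !inE.
  by do 6![case: (_ \in _)].
split=> //.
have sumE : \sum_(x in J) k x + \sum_(x in M) k x
          = \sum_(x in C) k x + \sum_(x in D) k x.
  rewrite big_mkcond [X in _ + X]big_mkcond [X in _ = X + _]big_mkcond.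
  rewrite [X in _ = _ + X]big_mkcond -!big_split /=; apply: eq_bigr => x _.
  by rewrite !inE; do 3![case: (_ \in _)]; rewrite ?addn0 ?add0n.
have := tmin _ covM; lia.
Qed.

(** The inductive step of the weighted Koenig theorem: some edge ab can be
    removed from the capacities at the price of a single unit of cover weight.
    The edge ab fails only if a cover of least weight t + 1 contains both ends.
    Fix a on the side A; if there are covers of least weight through a, let C be
    one that is largest outside A.  It misses some neighbour b of a
    of positive capacity, since otherwise a could be dropped from C; and a cover
    of least weight through a and b could be crossed with C to give a larger
    one. *)
Lemma exists_good_edge e A k t :
  ssrbool.symmetric e -> (forall x y, e x y -> (x \in A) != (y \in A)) ->
  (forall C, vertex_cover e C -> t.+1 <= \sum_(x in C) k x) ->
  exists a b, [/\ e a b, 0 < k a, 0 < k b &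
    forall C, vertex_cover e C -> a \in C -> b \in C ->
      t.+2 <= \sum_(x in C) k x].
Proof.
move=> sym bip cov.
pose Z := [set x | k x == 0].
have [a [b0 [eab0 ka kb0 aA]]] :
    exists a b, [/\ e a b, 0 < k a, 0 < k b & a \in A].
  have : ~~ vertex_cover e Z.
    apply/negP => /cov; rewrite big1 // => x; rewrite inE => /eqP; exact.
  rewrite /vertex_cover negb_forall => /existsP[x].
  rewrite negb_forall => /existsP[y].
  rewrite negb_imply negb_or !inE -!lt0n => /and3P[exy kx ky].
  have [xA|xA] := boolP (x \in A); first by exists x, y.
  exists y, x; split=> //; first by rewrite sym.
  by have := bip _ _ exy; rewrite (negbTE xA); case: (y \in A).
pose P C := [&& vertex_cover e C, a \in C & \sum_(x in C) k x <= t.+1].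
have [[C0 PC0]|noP] := pselect (exists C, P C); last first.
  exists a, b0; split=> // C covC aC _; rewrite ltnNge; apply/negP => le.
  by apply: noP; exists C; apply/and3P.
have [C /and3P[covC aC kC] Cmax] := arg_maxnP (fun C => #|C :\: A|) PC0.
(* otherwise C without a, plus the vertices of capacity 0, is too light *)
have [b [eab kb bC]] : exists b, [/\ e a b, 0 < k b & b \notin C].
  apply: contrapT => nob.
  have : vertex_cover e (C :\ a :|: Z).
    apply/vertex_coverP => x y exy; rewrite !inE.
    have nb z : e a z -> (z \in C) || (k z == 0).
      move=> eaz; have [//|zC /=] := boolP (z \in C).
      by rewrite -leqn0 leqNgt; apply/negP => kz; apply: nob; exists z.
    have eaa : e a a = false by apply/negP => /bip; rewrite eqxx.
    have [xa|xa] := eqVneq x a.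
      rewrite xa in exy *.
      have ya : y != a by apply: contraTneq exy => ->; rewrite eaa.
      by rewrite ya /=; have /orP[]:= nb _ exy => ->; rewrite ?orbT.
    have [ya|ya] := eqVneq y a.
      by rewrite ya sym in exy; have /orP[]:= nb _ exy => ->; rewrite ?orbT.
    by have /vertex_coverP/(_ x y exy)/orP[] := covC => -> /=; rewrite ?orbT.
  move/cov; apply/negP; rewrite -ltnNge; apply: leq_trans kC.
  rewrite (big_setD1 a aC) /=.
  suff : \sum_(x in C :\ a :|: Z) k x <= \sum_(x in C :\ a) k x by lia.
  rewrite big_mkcond [X in _ <= X]big_mkcond /=; apply: leq_sum => x _.
  rewrite !inE; case: (eqVneq (k x) 0) => [->|_]; first by case: ifP.
  by rewrite orbF.
exists a, b; split=> // D covD aD bD; rewrite ltnNge; apply/negP => kD.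
have [covJ kJ] := tight_pair_cover bip cov covC covD kC kD.
set J := [set x | _] in covJ kJ.
have bA : b \notin A by have := bip _ _ eab; rewrite aA; case: (b \in A).
have /Cmax : P J by apply/and3P; split=> //; rewrite inE aA aC.
apply/negP; rewrite -ltnNge; apply: proper_card.
apply/properP; split.
  apply/fintype.subsetP => x; rewrite !inE => /andP[xA xC].
  by rewrite (negbTE xA) xC.
by exists b; rewrite !inE (negbTE bA) ?bD ?orbT //= bC.
Qed.

(** The nontrivial half of the weighted Koenig theorem. *)
Lemma bipartite_duality e A k t :
  ssrbool.symmetric e -> (forall x y, e x y -> (x \in A) != (y \in A)) ->
  (forall C, vertex_cover e C -> t <= \sum_(x in C) k x) ->
  edges_within e k t.
Proof.
move=> sym bip; elim: t k => [|t IH] k cov.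
  by exists [::]; split=> // v; rewrite /edge_deg big_nil.
have [a [b [eab ka kb good]]] := exists_good_edge sym bip cov.
have ab : a != b by apply: contraTneq eab => ->; apply/negP => /bip;
  rewrite eqxx.
pose k' x := k x - ((a == x) + (b == x)).
have kE x : k x = k' x + ((a == x) + (b == x)).
  rewrite subnK //; case: (eqVneq a x) => [<-|_] /=.
    by rewrite eq_sym (negbTE ab).
  by case: eqP => [<-|].
have [C covC|s [sz se sd]] := IH k'.
  have sumE : \sum_(x in C) k x = \sum_(x in C) k' x + ((a \in C) + (b \in C)).
    by rewrite (eq_bigr _ (fun x _ => kE x)) !big_split /= !sum_pred1.
  have := cov C covC; have := good C covC; rewrite sumE.
  have /vertex_coverP/(_ _ _ eab) := covC.
  case: (a \in C); case: (b \in C) => //= _; first by move/(_ isT isT); lia.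
    by move=> _; lia.
  by move=> _; lia.
exists ((a, b) :: s); split=> /=; [by rewrite sz|by rewrite eab|].
by move=> v; rewrite edge_deg_cons /= kE addnC leq_add2r.
Qed.

(** * Odd cycles and bipartitions *)

Lemma repeated_entry (c : seq T) :
  ~~ uniq c -> exists x p q r, c = p ++ (x :: q) ++ x :: r.
Proof.
elim: c => //= y c IH; rewrite negb_and negbK => /orP[yc|/IH].
  by case/splitPr: yc => q r; exists y, [::], q, r.
by case=> x [p [q [r ->]]]; exists x, (y :: p), q, r.
Qed.

(** At a repeated vertex an odd closed walk splits into two shorter closed
    walks, one of which is odd. *)
Lemma odd_closed_walk_cycle e c :
  irreflexive e -> cycle e c -> odd (size c) ->
  exists c', [/\ 2 < size c', odd (size c') & ucycle e c'].
Proof.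
move=> irr; have [m] := ubnP (size c).
elim: m c => // m IH c szc cyc oddc.
have [uc|/repeated_entry[x [p [q [r cE]]]]] := boolP (uniq c).
  exists c; split=> //; last by rewrite /ucycle cyc.
  by move: c cyc oddc {szc uc} => [|x [|y [|z c]]] //=; rewrite irr.
have [cyc1 cyc2] : cycle e (x :: q) /\ cycle e (x :: r ++ p).
  move: cyc; rewrite cE -(rot_cycle (size p)) rot_size_cat /=.
  rewrite -catA rcons_cat cat_path /= => /and3P[pq lq pr].
  by rewrite !rcons_path pq /=; move: pr; rewrite rcons_path => /andP[-> ->].
have szE : size c = size (x :: q) + size (x :: r ++ p).
  by rewrite cE !size_cat /= !size_cat; lia.
have [o|o] := boolP (odd (size (x :: q))).
  by apply: IH cyc1 o; move: szc; rewrite szE /=; lia.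
apply: IH cyc2 _; first by move: szc; rewrite szE /=; lia.
by move: oddc; rewrite szE oddD (negbTE o).
Qed.

(** In the bipartite double cover, a connection between the two copies of a
    vertex projects to an odd closed walk.  If there is none, each component of
    the graph is coloured by the sheet reached from its root. *)
Lemma odd_cycle_or_bipartite e :
  ssrbool.symmetric e -> irreflexive e ->
  (exists c, [/\ 2 < size c, odd (size c) & ucycle e c]) \/
  exists A : {set T}, forall x y, e x y -> (x \in A) != (y \in A).
Proof.
move=> sym irr.
pose e2 := [rel u v : T * bool | e u.1 v.1 && (u.2 != v.2)].
have sym2 : connect_sym e2.
  by apply: sym_connect_sym => u v /=; rewrite sym eq_sym.
have pathE (p : seq (T * bool)) u : path e2 u p ->
    path e u.1 (map fst p) /\ (last u p).2 = u.2 (+) odd (size p).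
  elim: p u => [|v p IH] u /=; first by rewrite addbF.
  case/andP=> /andP[euv uv] /IH[-> ->]; rewrite euv; split=> //.
  by case: u.2 uv; case: v.2 => //=; case: (odd _).
have [[x /connectP[p pp lp]]|nox] :=
    pselect (exists x, connect e2 (x, false) (x, true)).
  left; have [pp1 /=] := pathE _ _ pp; rewrite -lp /= => oddp.
  have lastE : last x (map fst p) = x.
    by rewrite -[X in last X](erefl (x, false).1) last_map -lp.
  move: (map fst p) pp1 lastE (size_map fst p) => /= q; case/lastP: q => [|q y].
    by move=> _ _ sz; move: oddp; rewrite -sz.
  rewrite last_rcons size_rcons => pq yx sz; rewrite yx in pq.
  apply: (@odd_closed_walk_cycle e (x :: q)) => //.
  by rewrite [size _]sz -oddp.
right.
have csym : connect_sym e by apply: sym_connect_sym.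
exists [set x | connect e2 (fingraph.root e x, false) (x, false)] => x y exy.
rewrite !inE; have -> : fingraph.root e y = fingraph.root e x.
  by apply/esym/eqP; rewrite root_connect // connect1.
set r := fingraph.root e x.
have step b : connect e2 (r, false) (x, b) = connect e2 (r, false) (y, ~~ b).
  by apply: same_connect_r => //; apply: connect1; rewrite /= exy; case: b.
have nb z :
    ~ (connect e2 (r, false) (z, false) /\ connect e2 (r, false) (z, true)).
  case=> h1 h2; apply: nox; exists z; apply: connect_trans h2; by rewrite sym2.
have [b rb] : exists b, connect e2 (r, false) (x, b).
  have /connectP[p pp ->] : connect e r x by rewrite csym connect_root.
  elim/last_ind: p pp => [_|p z IH]; first by exists false.
  rewrite rcons_path last_rcons => /andP[/IH[b rb] ez]; exists (~~ b).
  by apply: connect_trans rb _; apply: connect1; rewrite /= ez; case: b.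
case: b rb => rb; have rb' := rb; rewrite step /= in rb'.
  by rewrite rb'; apply/eqP => h; apply: (nb x).
by rewrite rb; apply/eqP => h; apply: (nb y).
Qed.

Lemma path_edges_within e (c : seq T) t :
  uniq c -> sorted e c -> t.*2 <= size c -> edges_within e (fun v => v \in c) t.
Proof.
elim: t c => [|t IH] c.
  by move=> _ _ _; exists [::]; split=> // v; rewrite /edge_deg big_nil.
case: c => [|x [|y c]] //= /and3P[xc yc uc] /andP[exy pc] sz.
have [|s [szs es ds]] := IH c uc (path_sorted pc); first by move: sz; lia.
exists ((x, y) :: s); split=> /=; [by rewrite szs|by rewrite exy|].
move=> v; rewrite edge_deg_cons /= !inE ![v == _]eq_sym.
move: xc; rewrite inE negb_or => /andP[xy xc].
have := ds v; case: eqP => [xv|_]; case: eqP => [yv|_] /=; try by lia.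
- by move: xy; rewrite xv yv eqxx.
- by rewrite -xv (negbTE xc); lia.
- by rewrite -yv (negbTE yc); lia.
Qed.

(** The restriction of the graph to the support of k either contains an odd
    cycle, which is then long enough to provide t disjoint edges of capacity 1,
    or is bipartite. *)
Lemma edges_within_cover e k t :
  ssrbool.symmetric e -> irreflexive e ->
  (forall r, 2 <= r <= t -> ~ contains_cycle e (2 * r - 1)) ->
  (forall C, vertex_cover e C -> t <= \sum_(x in C) k x) ->
  edges_within e k t.
Proof.
move=> sym irr noc cov.
pose e' := [rel x y | [&& e x y, 0 < k x & 0 < k y]].
suff : edges_within e' k t.
  case=> s [szs es ds]; exists s; split=> //; apply: sub_all es => p.
  by case/and3P.
have sym' : ssrbool.symmetric e'.
  by move=> x y; rewrite /= sym [X in _ && X]andbC.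
have irr' : irreflexive e' by move=> x; rewrite /= irr.
have [[c [szc oddc /andP[cyc uc]]]|[A bip]] := odd_cycle_or_bipartite sym' irr'.
  have sizeE : size c = 2 * (size c)./2.+1 - 1.
    by rewrite -[LHS]odd_double_half oddc; lia.
  have lt : t < (size c)./2.+1.
    rewrite ltnNge; apply/negP => le; apply: (noc (size c)./2.+1).
      by rewrite le andbT; lia.
    exists c; rewrite -sizeE; split=> //; rewrite /ucycle uc andbT.
    by apply: sub_cycle cyc => x y /and3P[].
  have [||s [szs es ds]] := @path_edges_within e' c t uc; last 1 first.
  - exists s; split=> // v; apply: leq_trans (ds v) _.
    have [vc|//] := boolP (v \in c).
    by have /and3P[_ ->] := next_cycle cyc vc.
  - by case: c cyc {szc oddc uc sizeE lt} => // x c;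
      rewrite /= rcons_path => /andP[].
  - by rewrite sizeE; lia.
apply: (bipartite_duality sym' bip) => C /vertex_coverP covC.
(* a cover of the support becomes a cover of the graph at no cost *)
have : vertex_cover e (C :|: [set x | k x == 0]).
  apply/vertex_coverP => x y exy; rewrite !inE.
  case: eqP => [|/eqP kx]; first by rewrite orbT.
  case: (eqVneq (k y) 0) => [_|ky]; first by rewrite !orbT.
  by have := covC x y; rewrite /= exy !lt0n kx ky !orbF => /(_ isT).
move/cov/leq_trans; apply.
rewrite big_mkcond [X in _ <= X]big_mkcond /=; apply: leq_sum => x _.
by rewrite !inE; case: (x \in C); case: eqP => //= ->.
Qed.

(** Each edge of the cycle has an end in C, and each entry belongs to two edges;
    for an odd cycle of length 2s - 1 this makes at least s entries in C. *)
Lemma cycle_cover_count e C (c : seq T) :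
  vertex_cover e C -> cycle e c -> size c <= (count (mem C) c).*2.
Proof.
move=> /vertex_coverP cov; case: c => // x c.
have walk (p : seq T) y : path e y p ->
    size p <= count (mem C) (belast y p) + count (mem C) p.
  elim: p y => [|z p IH] y //= /andP[eyz /IH].
  by have /orP[]:= cov _ _ eyz => ->; lia.
move=> /walk; rewrite belast_rcons size_rcons -cats1 count_cat /=; lia.
Qed.
End Matchings.

(** * Monomial ideals and localization *)

Section IdealTheory.
Import GRing.Theory.
Local Open Scope classical_set_scope.
Local Open Scope ring_scope.

Section Generated.
Variable R : comNzRingType.
Implicit Types (A I J : set R).

Lemma ideal_of_setT : ideal_of (@setT R) setT.
Proof. by split. Qed.

Lemma ideal_gen_ideal A : ideal_of setT (ideal_gen setT A).
Proof.
split=> //.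
- by move=> J [[]].
- by move=> x y Ix Iy J JA; have [[_ _ add _] _] := JA; apply: add;
    [apply: Ix|apply: Iy].
- by move=> a x _ Ix J JA; have [[_ _ _ mul] _] := JA; apply: mul => //;
    apply: Ix.
Qed.

Lemma ideal_pow_ideal A t : ideal_of setT (ideal_pow (ideal_gen setT A) t).
Proof. by case: t => [|t]; [exact: ideal_of_setT|exact: ideal_gen_ideal]. Qed.

Lemma ideal_sum J (T : eqType) (r : seq T) (F : T -> R) :
  ideal_of setT J -> (forall i, i \in r -> J (F i)) -> J (\sum_(i <- r) F i).
Proof.
move=> [_ J0 JD _] JF; rewrite big_seq_cond.
by elim/big_ind : _ => // i; rewrite andbT => /JF.
Qed.
End Generated.

(** Clearing denominators turns membership in the extension of J to R_p into
    membership in J up to a factor outside p. *)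
Lemma local_extP (R : idomainType) (p J : set R) (f : R) :
  prime_ideal p -> ideal_of setT J ->
  local_ext p J (tofrac f) <-> exists2 s, ~ p s & J (s * f).
Proof.
move=> [[_ p0 _ _] p1 pM] [_ J0 JD JM].
have nz s : ~ p s -> tofrac s != 0.
  by rewrite tofrac_eq0; move=> ps; apply/eqP => s0; apply: ps; rewrite s0.
split=> [|[s ps Jsf] Q [[_ _ _ QM] JQ]]; last first.
  have -> : tofrac f = (tofrac 1 / tofrac s) * tofrac (s * f).
    by rewrite tofracM tofrac1 mul1r mulKf ?nz.
  apply: QM; first by exists 1 => //; exists s.
  by apply: JQ; exists (s * f).
pose Q := [set z : {fraction R} |
  exists a s, [/\ J a, ~ p s & z = tofrac a / tofrac s]].
move=> /(_ Q) [|a [s [Ja ps]]].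
  split; last first.
    by move=> _ [a Ja <-]; exists a, 1; split=> //; rewrite tofrac1 divr1.
  split.
  - by move=> _ [a [s [Ja ps ->]]]; exists a => //; exists s.
  - by exists 0, 1; split=> //; rewrite tofrac0 mul0r.
  - move=> _ _ [a [s [Ja ps ->]]] [b [r [Jb pr ->]]].
    exists (r * a + s * b), (s * r); split; first by apply: JD; apply: JM.
      by move/pM => [].
    rewrite addf_div ?nz // tofracD !tofracM.
    by rewrite [X in X + _]mulrC [X in _ + X]mulrC.
  - move=> _ _ [a _ [s ps <-]] [b [r [Jb pr ->]]].
    exists (a * b), (s * r); split; first exact: JM.
      by move/pM => [].
    by rewrite mulf_div !tofracM.
move=> fE; exists s => //.
suff -> : s * f = a by [].
by apply/eqP; rewrite -tofrac_eq tofracM fE mulrC divfK ?nz.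
Qed.

Section MonomialIdeals.
Variables (n : nat) (K : fieldType).
Implicit Types (m u : 'X_{1..n}) (P : 'X_{1..n} -> Prop) (C : {set 'I_n}).
Implicit Types (f g s : {mpoly K[n]}).

(** For an upward closed P, the ideal spanned by the monomials in P. *)
Definition monomial_ideal P : set {mpoly K[n]} :=
  [set f | forall m, m \in msupp f -> P m].

Definition up_closed P := forall u m, P m -> P (u + m)%MM.

Lemma monomial_idealM P1 P2 P f g :
  (forall m1 m2, P1 m1 -> P2 m2 -> P (m1 + m2)%MM) ->
  monomial_ideal P1 f -> monomial_ideal P2 g -> monomial_ideal P (f * g).
Proof.
move=> PM Pf Pg _ /msuppM_le/allpairsP[[m1 m2] /= [m1f m2g ->]].
by apply: PM; [apply: Pf|apply: Pg].
Qed.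

Lemma monomial_ideal_ideal P : up_closed P -> ideal_of setT (monomial_ideal P).
Proof.
move=> up; split=> //.
- by move=> m; rewrite msupp0.
- move=> f g Pf Pg m /msuppD_le; rewrite mem_cat => /orP[];
    [exact: Pf|exact: Pg].
- move=> a f _; apply: (@monomial_idealM (fun=> True)) => // m1 m2 _; exact: up.
Qed.

Lemma monomial_idealX P m : monomial_ideal P 'X_[m] <-> P m.
Proof.
split=> [|Pm m']; first by apply; rewrite msuppX inE.
by rewrite msuppX inE => /eqP ->.
Qed.

Lemma monomial_ideal_sub P J :
  ideal_of setT J -> (forall m, P m -> J 'X_[m]) -> monomial_ideal P `<=` J.
Proof.
move=> idJ JX f Pf; rewrite [f]mpolyE; apply: ideal_sum => // m mf.
have [_ _ _ JM] := idJ.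
by rewrite -mul_mpolyC; apply: JM => //; apply/JX/Pf.
Qed.

Definition mpoly_part (Q : pred 'X_{1..n}) f : {mpoly K[n]} :=
  \sum_(m <- msupp f | Q m) f@_m *: 'X_[m].

Lemma mcoeff_mpoly_part Q f m : (mpoly_part Q f)@_m = if Q m then f@_m else 0.
Proof.
rewrite {2}[f]mpolyE /mpoly_part !raddf_sum /=; case: ifP => Qm; last first.
  rewrite big1 // => m' Qm'; rewrite mcoeffZ mcoeffX.
  by case: eqP => [mm|]; rewrite ?mulr0 //; rewrite mm Qm in Qm'.
rewrite big_mkcond; apply: eq_bigr => m' _; rewrite mcoeffZ mcoeffX.
by case: eqP => [->|_]; rewrite ?Qm // mulr0; case: ifP.
Qed.

Lemma msupp_mpoly_part Q f m :
  (m \in msupp (mpoly_part Q f)) = Q m && (m \in msupp f).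
Proof. by rewrite !mcoeff_msupp mcoeff_mpoly_part; case: (Q m);
  rewrite ?eqxx. Qed.

Lemma mpoly_partC Q f : f - mpoly_part Q f = mpoly_part (predC Q) f.
Proof.
apply/mpolyP => m; rewrite mcoeffB !mcoeff_mpoly_part /=.
by case: (Q m); rewrite ?subrr ?subr0.
Qed.

Definition involves C m := [exists i in C, m i != 0%N].
Definition cdeg C m := (\sum_(i in C) m i)%N.

Lemma cdegD C m1 m2 : cdeg C (m1 + m2)%MM = (cdeg C m1 + cdeg C m2)%N.
Proof. by rewrite /cdeg -big_split; apply: eq_bigr => i _; rewrite mnmDE. Qed.

Lemma involvesE C m : involves C m = (cdeg C m != 0%N).
Proof.
rewrite /cdeg sum_nat_eq0 negb_forall; apply: eq_existsb => i.
by rewrite negb_imply.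
Qed.

Definition var_ideal C := monomial_ideal (involves C).

(** If P depends only on the exponents in C, then s outside the prime
    (x_i, i in C) is a nonzerodivisor modulo the ideal of P.  Let g collect the
    terms of f outside the ideal; the component of lowest C-degree in s g is the
    product of the terms of s free of C by the lowest component of g.  This is
    nonzero in a domain, and its monomials have the C-part of monomials of g, so
    they do not satisfy P.  With P the monomials of the prime itself this gives
    primality; with P local membership in a power of the edge ideal it computes
    symbolic powers. *)
Lemma var_saturation P C s f :
  up_closed P -> (forall u m, ~~ involves C u -> P (u + m)%MM -> P m) ->
  ~ var_ideal C s -> monomial_ideal P (s * f) -> monomial_ideal P f.
Proof.
move=> up satP Cs Psf; have [_ _ PD PM] := monomial_ideal_ideal up.
pose g := mpoly_part (fun m => `[< ~ P m >]) f.
have [g0|g_neq0] := eqVneq g 0.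
  move=> m mf; apply: contrapT => nP.
  have : m \in msupp g by rewrite msupp_mpoly_part mf andbT; apply/asboolP.
  by rewrite g0 msupp0.
have gP m : m \in msupp g -> ~ P m.
  by rewrite msupp_mpoly_part => /andP[/asboolP].
have Psg : monomial_ideal P (s * g).
  have -> : s * g = s * f + (- s) * (f - g).
    by rewrite mulrBr !mulNr opprK addrA subrr add0r.
  apply: PD => //; apply: PM => // m;
    rewrite mpoly_partC msupp_mpoly_part => /andP[/= + _].
  by move/asboolPn/contrapT.
have [m0 m0g m0min] : exists2 m0, m0 \in msupp g &
    forall m, m \in msupp g -> (cdeg C m0 <= cdeg C m)%N.
  have : exists d, has (fun m => cdeg C m == d) (msupp g).
    have : msupp g != [::] by rewrite msupp_eq0.
    by case: (msupp g) => // m r _; exists (cdeg C m); rewrite /= eqxx.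
  move=> /[dup] ex; case: (ex_minnP ex) => d /hasP[m0 m0g /eqP dE] dmin _.
  exists m0 => // m mg; rewrite dE; apply: dmin; apply/hasP; by exists m.
pose gd := mpoly_part (fun m => cdeg C m == cdeg C m0) g.
pose s0 := mpoly_part (fun m => ~~ involves C m) s.
have gd_neq0 : gd != 0.
  by rewrite -msupp_eq0; apply/eqP => e;
    have := msupp_mpoly_part (fun m => cdeg C m == cdeg C m0) g m0;
    rewrite -/gd e m0g eqxx.
have s0_neq0 : s0 != 0.
  apply/eqP => e; apply: Cs => m ms; apply: contrapT => /negP nm.
  by have := msupp_mpoly_part (fun m => ~~ involves C m) s m;
    rewrite -/s0 e msupp0 nm ms.
have [m mE] : exists m, m \in msupp (s0 * gd).
  have : msupp (s0 * gd) != [::] by rewrite msupp_eq0 mulf_neq0.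
  by case: (msupp _) => // m r _; exists m; rewrite inE eqxx.
have /allpairsP[[m1 m2] /= [m1s m2g m12]] := msuppM_le mE.
move: m1s m2g; rewrite (msupp_mpoly_part _ s) (msupp_mpoly_part _ g).
move=> /andP[m1C m1s] /andP[/eqP m2d m2g].
have m1C0 : cdeg C m1 = 0%N by apply/eqP; move: m1C; rewrite involvesE negbK.
have cm : cdeg C m = cdeg C m0 by rewrite m12 cdegD m1C0 m2d.
(* all terms of s g outside s0 gd have a larger C-degree than m *)
have : m \in msupp (s * g).
  have -> : s * g = s0 * gd + (s0 * (g - gd) + (s - s0) * g).
    by rewrite addrA -mulrDr [gd + _]addrC subrK mulrBl addrC subrK.
  have low1 : (s0 * (g - gd))@_m = 0.
    apply/eqP; rewrite mcoeff_eq0; apply/negP.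
    move/msuppM_le/allpairsP => [[a b] /= [_]];
      rewrite mpoly_partC msupp_mpoly_part.
    move=> /andP[/= bd bg] ab; have := m0min _ bg; move: cm; rewrite ab cdegD.
    by move: bd; lia.
  have low2 : ((s - s0) * g)@_m = 0.
    apply/eqP; rewrite mcoeff_eq0; apply/negP.
    move/msuppM_le/allpairsP => [[a b] /= []];
      rewrite mpoly_partC msupp_mpoly_part.
    move=> /andP[/= + _] bg ab; have := m0min _ bg; move: cm; rewrite ab cdegD.
    by rewrite negbK involvesE; lia.
  by rewrite mcoeff_msupp !mcoeffD low1 low2 !addr0 -mcoeff_msupp.
by move/Psg; rewrite m12 => /(satP _ _ m1C) Pm2; case: (gP _ m2g Pm2).
Qed.

Lemma var_ideal_prime C : prime_ideal (var_ideal C).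
Proof.
have up : up_closed (involves C).
  by move=> u m; rewrite !involvesE cdegD; lia.
split; first exact: monomial_ideal_ideal.
- move=> /(_ 0%MM); rewrite msupp1 inE eqxx => /(_ isT).
  by rewrite involvesE /cdeg big1 // => i _; rewrite mnm0E.
- move=> x y xy; have [|xC] := pselect (var_ideal C x); [by left|right].
  apply: (var_saturation up _ xC xy) => u m.
  by rewrite !involvesE cdegD; lia.
Qed.

Lemma var_idealX C i : var_ideal C 'X_i <-> i \in C.
Proof.
rewrite /var_ideal monomial_idealX involvesE /cdeg.
under eq_bigr do rewrite mnm1E.
by rewrite sum_pred1; case: (i \in C).
Qed.

Lemma var_ideal_sub p C :
  prime_ideal p -> (forall i, i \in C -> p 'X_i) -> var_ideal C `<=` p.
Proof.
move=> [idp _ _] pC; apply: monomial_ideal_sub => // m /existsP[i /andP[iC mi]].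
have -> : m = (m - U_(i) + U_(i))%MM.
  rewrite submK //; apply/mnm_lepP => j; rewrite mnm1E; case: eqP => // <-.
  by rewrite lt0n.
by rewrite mpolyXD; have [_ _ _ pM] := idp; apply: pM => //; apply: pC.
Qed.
End MonomialIdeals.
End IdealTheory.

Arguments monomial_ideal {n} K P.
Arguments var_ideal {n} K C.
Arguments var_idealX {n} K C i.

(** * The edge ideal, its powers and its symbolic powers *)

Section EdgeIdeal.
Variables (n : nat) (D : wograph n).
Implicit Types (m u : 'X_{1..n}) (C : {set 'I_n}) (t : nat).
Implicit Types (p : 'I_n * 'I_n) (s : seq ('I_n * 'I_n)).

Local Notation adj := (underlying_graph D).

Lemma edge_underlying i j : edge D i j -> adj i j.
Proof. by move=> eij; apply/orP; left. Qed.

Definition edge_mnm p : 'X_{1..n} := (U_(p.1) + U_(p.2) *+ weight D p.2)%MM.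

Definition in_edge_pow t m :=
  exists s, [/\ size s = t, all (fun p => edge D p.1 p.2) s
              & ((\sum_(p <- s) edge_mnm p)%MM <= m)%MM].

Lemma edge_mnmE p v : edge_mnm p v = (p.1 == v) + (p.2 == v) * weight D v.
Proof. by rewrite mnmDE mulmnE !mnm1E; case: (p.2 =P v) => [->|]. Qed.

Lemma in_edge_pow0 m : in_edge_pow 0 m.
Proof. by exists [::]; rewrite big_nil; split=> //; apply/mnm_lepP => i;
  rewrite mnm0E. Qed.

Lemma in_edge_powD a b m1 m2 :
  in_edge_pow a m1 -> in_edge_pow b m2 -> in_edge_pow (a + b) (m1 + m2).
Proof.
move=> [s1 [z1 e1 /mnm_lepP d1]] [s2 [z2 e2 /mnm_lepP d2]].
exists (s1 ++ s2); split; first by rewrite size_cat z1 z2.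
  by rewrite all_cat e1.
apply/mnm_lepP => i; rewrite big_cat !mnmDE; exact: leq_add.
Qed.

Lemma in_edge_pow_up t : up_closed (in_edge_pow t).
Proof. by move=> u m; apply: (@in_edge_powD 0); apply: in_edge_pow0. Qed.

Lemma in_edge_pow_le t t' m : t' <= t -> in_edge_pow t m -> in_edge_pow t' m.
Proof.
move=> tt [s [z e /mnm_lepP d]]; exists (take t' s); split.
- by rewrite size_take z; case: ltngtP tt.
- by move: e; rewrite -{1}(cat_take_drop t' s) all_cat => /andP[].
- apply/mnm_lepP => i; apply: leq_trans (d i).
  by rewrite -{2}(cat_take_drop t' s) big_cat mnmDE leq_addr.
Qed.

Lemma edge_pow_mnm i j : edge D i j -> in_edge_pow 1 (edge_mnm (i, j)).
Proof.
move=> eij; exists [:: (i, j)]; split=> //=; first by rewrite eij.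
by rewrite big_seq1; apply/mnm_lepP.
Qed.

(** Monomials in the localization of I^t at the prime of C: variables outside C
    are units there. *)
Definition local_edge_pow C t m :=
  exists2 u, ~~ involves C u & in_edge_pow t (u + m).

Lemma local_edge_powD C a b m1 m2 :
  local_edge_pow C a m1 -> local_edge_pow C b m2 ->
  local_edge_pow C (a + b) (m1 + m2).
Proof.
move=> [u1 c1 h1] [u2 c2 h2]; exists (u1 + u2)%MM.
  by move: c1 c2; rewrite !involvesE cdegD; lia.
have -> : (u1 + u2 + (m1 + m2) = u1 + m1 + (u2 + m2))%MM.
  by apply/mnmP => i; rewrite !mnmDE addnACA.
exact: in_edge_powD.
Qed.

Lemma local_edge_pow_global C t m : in_edge_pow t m -> local_edge_pow C t m.
Proof.
by exists 0%MM; rewrite ?add0m // involvesE /cdeg big1 // => i _; rewrite mnm0E.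
Qed.

Lemma local_edge_pow_up C t : up_closed (local_edge_pow C t).
Proof.
move=> u m [v vC h]; exists v => //; by rewrite addmA [(v + u)%MM]addmC -addmA;
  apply: in_edge_pow_up.
Qed.

Lemma local_edge_pow_le C t t' m m' :
  t' <= t -> (m <= m')%MM -> local_edge_pow C t m -> local_edge_pow C t' m'.
Proof.
move=> tt mm; rewrite -(submK mm) => h; apply: local_edge_pow_up.
by case: h => u uC h; exists u => //; apply: in_edge_pow_le h.
Qed.

Lemma local_edge_pow_saturated C t u m :
  ~~ involves C u -> local_edge_pow C t (u + m) -> local_edge_pow C t m.
Proof.
move=> uC [v vC h]; exists (v + u)%MM; last by rewrite -addmA.
by move: uC vC; rewrite !involvesE cdegD; lia.
Qed.

Section Algebra.
Import GRing.Theory.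
Local Open Scope classical_set_scope.
Local Open Scope ring_scope.
Variable K : fieldType.
Local Notation I := (edge_ideal K D).

Lemma mpolyX_edge_mnm p :
  'X_[edge_mnm p] = 'X_p.1 * 'X_p.2 ^+ weight D p.2 :> {mpoly K[n]}.
Proof. by rewrite mpolyXD mpolyXn. Qed.

Lemma edge_idealX i j : edge D i j -> I ('X_i * 'X_j ^+ weight D j).
Proof. by move=> eij; apply: sub_gen_smallest; exists i, j. Qed.

Lemma edge_ideal_sub J : ideal_of setT J ->
  (forall i j, edge D i j -> J ('X_i * 'X_j ^+ weight D j)) -> I `<=` J.
Proof. by move=> idJ JX; apply: smallest_sub => // _ [i [j [eij ->]]];
  apply: JX. Qed.

Lemma edge_ideal_powE t : ideal_pow I t = monomial_ideal K (in_edge_pow t).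
Proof.
apply/seteqP; split.
  elim: t => [|t IH]; first by move=> f _ m _; apply: in_edge_pow0.
  apply: smallest_sub; first by apply: monomial_ideal_ideal;
    apply: in_edge_pow_up.
  move=> _ [x Ix [y /IH Iy <-]].
  have {}Ix : monomial_ideal K (in_edge_pow 1) x.
    move: x Ix; apply: edge_ideal_sub.
      by apply: monomial_ideal_ideal; apply: in_edge_pow_up.
    move=> i j eij; rewrite -(mpolyX_edge_mnm (i, j)) monomial_idealX.
    exact: edge_pow_mnm.
  by apply: monomial_idealM Ix Iy => m1 m2; apply: in_edge_powD.
apply: monomial_ideal_sub; first exact: ideal_pow_ideal.
move=> m [s [<- {t}]]; elim: s m => [|p s IH] m //= /andP[ep es].
rewrite big_cons => /mnm_lepP le.
have -> : m = (edge_mnm p + (m - edge_mnm p))%MM.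
  rewrite addmC submK //; apply/mnm_lepP => i; apply: leq_trans (le i).
  by rewrite mnmDE leq_addr.
rewrite mpolyXD; apply: sub_gen_smallest.
exists 'X_[edge_mnm p]; first by rewrite mpolyX_edge_mnm; apply: edge_idealX.
exists 'X_[(m - edge_mnm p)%MM] => //; apply: IH => //; apply/mnm_lepP => i.
by have := le i; rewrite mnmDE mnmBE; lia.
Qed.

Lemma edge_ideal_sub_var C : vertex_cover adj C -> I `<=` var_ideal K C.
Proof.
move=> /vertex_coverP cov; have [idC _ CM] := var_ideal_prime K C.
have [_ _ _ mulC] := idC.
apply: edge_ideal_sub => // i j eij.
have /orP[iC|jC] : (i \in C) || (j \in C) by apply/cov/edge_underlying.
  by rewrite mulrC; apply: (mulC) => //; apply/var_idealX.
apply: (mulC) => //; rewrite -(prednK (weight_gt0 D j)) exprSr.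
by apply: mulC => //; apply/var_idealX.
Qed.

(** For a minimal prime P of the edge ideal, these vertices determine P. *)
Definition prime_vars (P : set {mpoly K[n]}) := [set i | `[< P 'X_i >]]%SET.

Lemma prime_vars_cover P :
  prime_ideal P -> I `<=` P -> vertex_cover adj (prime_vars P).
Proof.
move=> [idP P1 PM] IP.
have PX x k : P (x ^+ k) -> P x.
  by elim: k => [|k IH]; rewrite ?expr0 // exprS => /PM[].
have one i j : edge D i j -> (i \in prime_vars P) || (j \in prime_vars P).
  move=> /edge_idealX/IP/PM[Pi|/PX Pj]; apply/orP; [left|right];
    by rewrite inE; apply/asboolP.
apply/vertex_coverP => i j /orP[|/one]; [exact: one|by rewrite orbC].
Qed.

Lemma var_ideal_prime_vars P : prime_ideal P ->
  var_ideal K (prime_vars P) `<=` P.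
Proof.
by move=> prP; apply: var_ideal_sub => // i; rewrite inE => /asboolP.
Qed.

Lemma var_ideal_sub_vars C C' : var_ideal K C `<=` var_ideal K C' ->
  C \subset C'.
Proof.
by move=> sub; apply/fintype.subsetP => i iC;
  apply/(var_idealX K)/sub/var_idealX.
Qed.

(** The vertices whose variables lie in a prime containing I form a vertex cover,
    as each edge yields a product in the prime; so the prime contains the one
    generated by the variables of that cover. *)
Lemma minimal_primesE P :
  minimal_primes I P <->
  exists2 C, minset (vertex_cover adj) C & P = var_ideal K C.
Proof.
split=> [[prP IP minP]|[C minC ->]].
  have covP := prime_vars_cover prP IP.
  have PE C : vertex_cover adj C -> var_ideal K C `<=` P -> var_ideal K C = P.
    by move=> covC; apply: minP;
      [apply: var_ideal_prime|apply: edge_ideal_sub_var].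
  have PV := PE _ covP (var_ideal_prime_vars prP).
  exists (prime_vars P) => //; apply/minsetP; split=> // B covB sBP.
  apply/eqP; rewrite finset.eqEsubset sBP /=; apply: var_ideal_sub_vars.
  rewrite PV (PE B covB) //; apply: var_ideal_sub => // i iB.
  by have /fintype.subsetP/(_ _ iB) := sBP; rewrite inE => /asboolP.
have covC := minsetp minC.
split; [exact: var_ideal_prime|exact: edge_ideal_sub_var|].
move=> Q prQ IQ QC; apply/seteqP; split=> //.
have VQ := var_ideal_prime_vars prQ.
suff <- : prime_vars Q = C by [].
apply: (minsetinf minC); first exact: prime_vars_cover.
by apply: var_ideal_sub_vars; apply: subset_trans VQ QC.
Qed.

(** Local membership in I^t depends only on the exponents in C, so an element
    outside the prime can be cancelled without leaving this monomial ideal. *)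
Lemma edge_ideal_symbolicE t :
  symbolic_pow I t = monomial_ideal K
    (fun m => forall C, minset (vertex_cover adj) C -> local_edge_pow C t m).
Proof.
have idI : ideal_of setT (ideal_pow I t) by apply: ideal_pow_ideal.
apply/seteqP; split=> f.
  move=> fsym m mf C minC.
  have /fsym/= : minimal_primes I (var_ideal K C) by apply/minimal_primesE;
    exists C.
  rewrite local_extP //; last exact: var_ideal_prime.
  rewrite edge_ideal_powE => -[s sC sf].
  apply: (@var_saturation n K (local_edge_pow C t) C s f) mf => //.
  - exact: local_edge_pow_up.
  - by move=> u m'; apply: local_edge_pow_saturated.
  - by move=> m' /sf; apply: local_edge_pow_global.
move=> floc _ /minimal_primesE[C minC ->] /=.
have prC := var_ideal_prime K C; rewrite local_extP //.
have [_ C1 CM] := prC; have [_ _ ID IM] := idI.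
pose J := [set g | exists2 s, ~ var_ideal K C s & ideal_pow I t (s * g)].
suff : J f by [].
move: f floc; apply: monomial_ideal_sub.
  split=> //.
  - by exists 1 => //; rewrite mulr0; case: idI.
  - move=> x y [r rC rx] [s sC sy]; exists (r * s); first by case/CM.
    by rewrite mulrDr; apply: ID; [rewrite mulrAC mulrC|rewrite -mulrA];
      apply: IM.
  - by move=> a x _ [s sC sx]; exists s => //; rewrite mulrCA; apply: IM.
move=> m /(_ C minC) [u uC um]; exists 'X_[u].
  by rewrite /var_ideal monomial_idealX; apply/negP.
by rewrite -mpolyXD edge_ideal_powE monomial_idealX.
Qed.

Lemma symbolic_eq_pow_monomial t :
  ideal_pow I t = symbolic_pow I t <->
  forall m, (forall C, minset (vertex_cover adj) C -> local_edge_pow C t m) ->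
            in_edge_pow t m.
Proof.
rewrite edge_ideal_powE edge_ideal_symbolicE; split=> [eqI m loc|h].
  by apply/(monomial_idealX K); rewrite eqI monomial_idealX.
apply/seteqP; split=> f hf m mf; last exact: h (hf m mf).
by move=> C _; apply: local_edge_pow_global; apply: hf.
Qed.
End Algebra.

(** * Covers and local membership *)

Lemma underlying_sym : ssrbool.symmetric adj.
Proof. by move=> x y; apply: orbC. Qed.

Lemma underlying_irr : irreflexive adj.
Proof. by move=> x; apply/negbTE/negP => /orP[]; rewrite edge_irr. Qed.

Lemma minimal_cover_neighbor C i :
  minset (vertex_cover adj) C -> i \in C -> exists2 j, adj i j & j \notin C.
Proof.
move=> minC iC; apply: contrapT => none.
have nbC j : adj i j -> j \in C.
  by move=> ij; apply: contrapT => /negP jC; apply: none; exists j.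
have cov : vertex_cover adj (C :\ i).
  apply/vertex_coverP => x y xy; rewrite !inE.
  have /vertex_coverP/(_ _ _ xy) := minsetp minC.
  have [xi|_] := eqVneq x i.
    rewrite xi in xy *; rewrite (nbC _ xy) andbT => _.
    by apply: contraTneq xy => ->; rewrite underlying_irr.
  have [yi|//] := eqVneq y i.
  by rewrite yi underlying_sym in xy; rewrite (nbC _ xy).
have := minsetinf minC cov (subsetDl _ _); move/setP/(_ i).
by rewrite !inE eqxx iC.
Qed.

Lemma not_involves_var C i k : i \notin C -> ~~ involves C (U_(i) *+ k)%MM.
Proof.
move=> iC; rewrite involvesE negbK /cdeg big1 // => j jC.
by rewrite mulmnE mnm1E; case: eqP jC => // <-; rewrite (negbTE iC).
Qed.

(** Inverting x_j turns the generator x_i x_j^w(j) into x_i. *)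
Lemma local_source C i j : edge D i j -> j \notin C -> local_edge_pow C 1 U_(i).
Proof.
move=> eij jC; exists (U_(j) *+ weight D j)%MM; first exact: not_involves_var.
by rewrite addmC; apply: (edge_pow_mnm eij).
Qed.

(** By minimality i has a neighbour outside C, whose variable is inverted; the
    generator of this edge then becomes x_i or x_i^w(i). *)
Lemma local_vertex C i :
  minset (vertex_cover adj) C -> i \in C ->
  local_edge_pow C 1 (U_(i) *+ weight D i).
Proof.
move=> minC iC; have [j /orP[ij|ji] jC] := minimal_cover_neighbor minC iC.
  apply: local_edge_pow_le (local_source ij jC) => //; apply/mnm_lepP => v.
  by rewrite mulmnE leq_pmulr // weight_gt0.
exists (U_(j) *+ 1)%MM; first exact: not_involves_var.
rewrite mulm1n; exact: (edge_pow_mnm ji).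
Qed.

Lemma edge_pow_mnm_pow i j r : edge D i j ->
  in_edge_pow r (edge_mnm (i, j) *+ r).
Proof.
move=> eij; elim: r => [|r IH]; first exact: in_edge_pow0.
by rewrite mulmS; apply: (@in_edge_powD 1) => //; apply: edge_pow_mnm.
Qed.

(** * A heavy vertex that is not a sink *)

(** A linear functional with value at least N on the generators certifies
    non-membership of the monomials on which it is below t N. *)
Lemma in_edge_pow_functional t m (c : 'I_n -> nat) N :
  (forall i j, edge D i j -> N <= c i + c j * weight D j) ->
  in_edge_pow t m -> t * N <= \sum_i c i * m i.
Proof.
move=> cN [s [<- es /mnm_lepP le]].
apply: (@leq_trans (\sum_i c i * (\sum_(p <- s) edge_mnm p)%MM i)); last first.
  by apply: leq_sum => i _; rewrite leq_mul2l le orbT.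
elim: s es {le} => [|p s IH] /= => [_|/andP[ep /IH le]]; first by rewrite mul0n.
under eq_bigr do rewrite big_cons mnmDE mulnDr.
rewrite big_split /= mulSn; apply: leq_add le.
apply: leq_trans (cN _ _ ep) _.
under eq_bigr do rewrite edge_mnmE mulnDr.
rewrite big_split /= (bigD1 p.1) //= (bigD1 (P := predT) p.2) //= !eqxx; lia.
Qed.

(** In the product of the t generators x_a x_b^w(b) and (x_b x_c^w(c))^(t-1), one
    factor x_b is removed. *)
Definition path_monomial a b c t : 'X_{1..n} :=
  (U_(a) + U_(b) *+ weight D b + U_(c) *+ weight D c
   + edge_mnm (b, c) *+ (t - 2))%MM.

(** Case analysis on the cover.  If c is in C, then x_c^w(c) is locally in I,
    and so is x_a or x_b^w(b).  If c is not in C, then b is in C and x_b itself is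
    locally in I, so that x_b^2, which divides x_b^w(b), is in I^2. *)
Lemma path_monomial_local C a b c t :
  2 <= t -> minset (vertex_cover adj) C -> edge D a b -> edge D b c ->
  1 < weight D b -> local_edge_pow C t (path_monomial a b c t).
Proof.
move=> ht minC eab ebc wb; rewrite -{1}(subnKC ht).
apply: local_edge_powD; last exact/local_edge_pow_global/edge_pow_mnm_pow.
have loc1 := local_vertex minC; have /vertex_coverP cov := minsetp minC.
have [cC|cC] := boolP (c \in C).
  apply: (@local_edge_powD C 1 1 _ _ _ (loc1 c cC)).
  have [bC|bC] := boolP (b \in C); last first.
    by rewrite addmC; apply: local_edge_pow_up; apply: local_source bC.
  by apply: local_edge_pow_up; apply: loc1.
have src := local_source ebc cC.
apply: local_edge_pow_le (local_edge_powD src src) => //.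
apply/mnm_lepP => v; rewrite !mnmDE !mulmnE !mnm1E.
by case: (b == v) => //=; lia.
Qed.

Lemma path_monomial_not_in a b c t :
  2 <= t -> edge D a b -> edge D b c -> ~ in_edge_pow t (path_monomial a b c t).
Proof.
move=> ht eab ebc.
have nba := edge_asym eab; have ncb := edge_asym ebc.
have ba : (b == a) = false by apply: contraTF eab => /eqP ->; rewrite edge_irr.
have cb : (c == b) = false by apply: contraTF ebc => /eqP ->; rewrite edge_irr.
have ca : (c == a) = false by apply: contraTF ebc => /eqP ->.
have wb := weight_gt0 D b; have wc := weight_gt0 D c.
pose N := 1 + weight D b * weight D c.
(* Coefficients with value exactly N on x_a x_b^w(b) and on x_b x_c^w(c), and
   value 1 on x_b: the monomial has value t N - 1.  All other generators, also
   those of an edge between a and c in either direction, have value at least N. *)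
pose f v := if v == a then N - weight D b else if v == b then 1 else
            if v == c then weight D b else N.
have xN : weight D b < N by rewrite /N add1n ltnS leq_pmulr.
have fa : f a = N - weight D b by rewrite /f eqxx.
have fb : f b = 1 by rewrite /f ba eqxx.
have fc : f c = weight D b by rewrite /f ca cb eqxx.
have fN v : v != a -> v != b -> v != c -> f v = N.
  by rewrite /f => /negbTE -> /negbTE -> /negbTE ->.
move=> /(in_edge_pow_functional (c := f) (N := N)) h.
have {h} : t * N <= \sum_i f i * path_monomial a b c t i.
  apply: h => i j eij; have wj := weight_gt0 D j.
  case: (eqVneq i a) => [ia|ia].
    rewrite ia in eij *; case: (eqVneq j a) => [ja|ja];
      first by rewrite ja edge_irr in eij.
    case: (eqVneq j b) => [->|jb]; first by rewrite fa fb mul1n subnK // ltnW.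
    case: (eqVneq j c) => [->|jc]; first by rewrite fa fc /N; lia.
    by rewrite (fN j) //; nia.
  case: (eqVneq i b) => [ib|ib].
    rewrite ib in eij *; case: (eqVneq j a) => [ja|ja].
      by rewrite ja (negbTE nba) in eij.
    case: (eqVneq j b) => [jb|jb]; first by rewrite jb edge_irr in eij.
    case: (eqVneq j c) => [->|jc]; first by rewrite fb fc.
    by rewrite (fN j) //; nia.
  case: (eqVneq i c) => [ic|ic]; last by rewrite (fN i) //; apply: leq_addr.
  rewrite ic in eij *; case: (eqVneq j a) => [ja|ja].
    by rewrite ja fc fa; move: xN; rewrite ja in wj; nia.
  case: (eqVneq j b) => [jb|jb]; first by rewrite jb (negbTE ncb) in eij.
  case: (eqVneq j c) => [jc|jc]; first by rewrite jc edge_irr in eij.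
  by rewrite (fN j) //; nia.
apply/negP; rewrite -ltnNge.
have sum_at d k : \sum_i f i * ((d == i) * k) = f d * k.
  rewrite (bigD1 d) //= eqxx mul1n big1 ?addn0 // => i id.
  by rewrite eq_sym (negbTE id) muln0.
rewrite (_ : \sum_i _ = \sum_i (f i * ((a == i) * 1)
   + f i * ((b == i) * (weight D b + (t - 2)))
   + f i * ((c == i) * (weight D c * (t - 1))))); last first.
  apply: eq_bigr => i _; rewrite -!mulnDr; congr (_ * _).
  rewrite !mnmDE !mulmnE edge_mnmE !mnm1E /=.
  by case: (c =P i) => [<-|_]; rewrite ?mul0n ?mul1n ?cb ?addn0; nia.
rewrite !big_split /= !sum_at fa fb fc {fa fb fc fN sum_at f} muln1 mul1n mulnA.
have -> : weight D b * weight D c = N - 1 by rewrite /N addKn.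
move: xN; rewrite -/N; clearbody N; move: (weight D b) => x xN.
by case: t ht => [|[|r]] // _; nia.
Qed.

(** * Heavy vertices as sinks *)

Section Sinks.
Hypothesis sinks : forall v : 'I_n, Vplus D v -> is_sink D v.

Lemma tail_weight i j : edge D i j -> weight D i = 1.
Proof.
move=> eij; apply/eqP; rewrite eqn_leq weight_gt0 andbT leqNgt; apply/negP.
by move=> /sinks/forallP/(_ j); rewrite eij.
Qed.

Lemma sum_edge_mnm_sinks s v : all (fun p => edge D p.1 p.2) s ->
  (\sum_(p <- s) edge_mnm p)%MM v = edge_deg s v * weight D v.
Proof.
elim: s => [|p s IH] /=; first by rewrite big_nil mnm0E /edge_deg big_nil.
case/andP=> ep /IH {}IH; rewrite big_cons mnmDE IH edge_deg_cons edge_mnmE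
  !mulnDl.
by case: (p.1 =P v) => [<-|_] //=; rewrite (tail_weight ep).
Qed.

(** An edge ij gives the generator x_i^w(i) x_j^w(j), because its tail, not being
    a sink, has weight 1; so exponents only matter in units of w. *)
Lemma in_edge_pow_sinks t m :
  in_edge_pow t m <-> edges_within adj (fun v => m v %/ weight D v) t.
Proof.
split=> [[s [sz es /mnm_lepP le]]|[s [sz es ds]]].
  exists s; split=> //; first by apply: sub_all es => p; apply: edge_underlying.
  by move=> v; rewrite leq_divRL ?weight_gt0 // -sum_edge_mnm_sinks.
(* the edges of a weighted matching are unoriented *)
pose orient p := if edge D p.1 p.2 then p else (p.2, p.1).
have eo : all (fun p => edge D p.1 p.2) (map orient s).
  rewrite all_map; apply: sub_all es => p /= /orP[] ep; rewrite /orient.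
    by rewrite ep.
  by rewrite (negbTE (edge_asym ep)).
exists (map orient s); split=> //; first by rewrite size_map.
apply/mnm_lepP => v; rewrite sum_edge_mnm_sinks //.
have -> : edge_deg (map orient s) v = edge_deg s v.
  rewrite /edge_deg big_map; apply: eq_bigr => p _; rewrite /orient.
  by case: ifP => //= _; rewrite addnC.
by rewrite -leq_divRL ?weight_gt0.
Qed.

Lemma local_edge_pow_sinks C t m :
  vertex_cover adj C -> local_edge_pow C t m ->
  t <= \sum_(v in C) m v %/ weight D v.
Proof.
move=> cov [u uC /in_edge_pow_sinks[s [<- es ds]]].
apply: leq_trans (cover_edge_deg cov es) _; apply: leq_sum => v vC.
move: (ds v); rewrite mnmDE; suff -> : u v = 0 by [].
by apply/eqP; apply: contraNT uC => uv; apply/existsP; exists v; rewrite vC.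
Qed.

Lemma sinks_no_short_odd_cycle_local t m :
  (forall r, 2 <= r <= t -> ~ contains_cycle adj (2 * r - 1)) ->
  (forall C, minset (vertex_cover adj) C -> local_edge_pow C t m) ->
  in_edge_pow t m.
Proof.
move=> noc loc; apply/in_edge_pow_sinks; apply: edges_within_cover => //.
- exact: underlying_sym.
- exact: underlying_irr.
move=> C /minset_exists[C' minC' sub].
apply: leq_trans (local_edge_pow_sinks (minsetp minC') (loc _ minC')) _.
rewrite [X in _ <= X](big_setID C') /= (finset.setIidPr sub); exact: leq_addr.
Qed.

Definition cycle_monomial (c : seq 'I_n) (i j : 'I_n) r : 'X_{1..n} :=
  (\sum_(v <- c) (U_(v) *+ weight D v) + edge_mnm (i, j) *+ r)%MM.

Lemma cycle_monomial_local C c i j r t :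
  minset (vertex_cover adj) C -> cycle adj c -> edge D i j ->
  t.*2 <= (size c).+1 + r.*2 -> local_edge_pow C t (cycle_monomial c i j r).
Proof.
move=> minC cyc eij le.
have count_le : size c <= (count (mem C) c).*2.
  exact: cycle_cover_count (minsetp minC) cyc.
apply: (@local_edge_pow_le C (count (mem C) c + r) t (cycle_monomial c i j r)).
- lia.
- exact/mnm_lepP.
apply: local_edge_powD; last exact/local_edge_pow_global/edge_pow_mnm_pow.
elim: (c) => [|v c' IH]; first by apply: local_edge_pow_global;
  apply: in_edge_pow0.
rewrite big_cons /=; have [vC|vC] := boolP (v \in C).
  by apply: local_edge_powD => //; apply: local_vertex.
exact: local_edge_pow_up.
Qed.

(** The degree counted in units of w(v) is too small: 2 for each generator,
    against size c + 2 r for the monomial. *)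
Lemma cycle_monomial_not_in c i j r t :
  edge D i j -> size c + r.*2 < t.*2 ->
    ~ in_edge_pow t (cycle_monomial c i j r).
Proof.
move=> eij lt /in_edge_pow_sinks[s [sz es ds]].
have : \sum_v edge_deg s v <= size c + r.*2.
  apply: (@leq_trans
    (\sum_v (\sum_(u <- c) (u == v) + edge_deg [:: (i, j)] v * r))).
    apply: leq_sum => v _; apply: leq_trans (ds v) _.
    rewrite -(leq_pmul2r (weight_gt0 D v)); apply: leq_trans (leq_divM _ _) _.
    have mnmE1 : edge_mnm (i, j) v = edge_deg [:: (i, j)] v * weight D v.
      by rewrite -sum_edge_mnm_sinks /= ?eij // big_seq1.
    rewrite mnmDE mulmnE mnmE1 mnm_sumE mulnDl mulnAC leq_add2r big_distrl /=.
    apply: leq_sum => u _.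
    by rewrite mulmnE mnm1E; case: (u =P v) => [->|].
  rewrite big_split /= exchange_big /= -big_distrl /= sum_edge_deg big_seq1.
  rewrite (eq_bigr (fun=> 1)) => [|u _]; last by rewrite sum_pred1.
  by rewrite big_const_seq count_predT iter_addn_0 mul1n -mul2n.
by rewrite sum_edge_deg /= big_const_seq count_predT iter_addn_0 sz; move: lt;
  lia.
Qed.
End Sinks.
End EdgeIdeal.

Theorem theorem2 (n : nat) (D : wograph n) (K : fieldType) (t : nat)
    (ht : (2 <= t)%N) :
  ideal_pow (edge_ideal K D) t = symbolic_pow (edge_ideal K D) t
  <->
  (forall v : 'I_n, Vplus D v -> is_sink D v) /\
  (forall s : nat, (2 <= s <= t)%N ->
     ~ contains_cycle (underlying_graph D) (2 * s - 1)%N).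
Proof.
rewrite symbolic_eq_pow_monomial; split=> [h|[sinks noc] m].
  have sinks v : Vplus D v -> is_sink D v.
    move=> /= wv; apply/forallP => w; apply/negP => evw.
    have /existsP[u /negPn euv] : [exists u, ~~ ~~ edge D u v].
      rewrite -negb_forall; apply: contraTN wv => /weight_source.
      by rewrite /Vplus /= => ->.
    apply: (path_monomial_not_in ht euv evw); apply: h => C minC.
    exact: path_monomial_local.
  split=> // s /andP[s2 st] [c [c2 szc /andP[cyc _]]].
  have [i [j eij]] : exists i j, edge D i j.
    rewrite -szc in c2; case: c cyc c2 {szc} => [|x [|y c]] //= cyc _.
    by have /andP[/orP[e|e] _] := cyc; [exists x, y|exists y, x].
  apply: (@cycle_monomial_not_in _ _ sinks c i j (t - s) t eij).
    by rewrite szc; lia.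
  by apply: h => C minC; apply: cycle_monomial_local => //; rewrite szc; lia.
exact: sinks_no_short_odd_cycle_local.
Qed.
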